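(* Suppose that $X$ is finite-dimensional and that each $f_i:X\to\,]-\infty,+\infty]$ is a proper polyhedral convex function for $i=1,\dots,m$. If $\mathbf{f}\Box\iota_\Delta$ is proper, then $\mathbf{f}\Box\iota_\Delta$ is a polyhedral convex function (so lower semicontinuous) and $\mathbf{f}\Box\iota_\Delta$ is exact.
   Context: $X$ is a real Hilbert space, $m\in\{1,2,\dots\}$, $\mathbf{X}=X^m$ is the product Hilbert space, $\Delta=\{(x,\dots,x):x\in X\}$ with orthogonal complement $\Delta^\perp$. $\mathbf{f}(x_1,\dots,x_m)=\sum_{i=1}^m f_i(x_i)$. $\iota_\Delta$ is the indicator function of $\Delta$; $(\mathbf{f}\Box\iota_\Delta)(\mathbf{x})=\inf_{\mathbf{u}\in\mathbf{X}}(\mathbf{f}(\mathbf{u})+\iota_\Delta(\mathbf{x}-\mathbf{u}))$; it is exact at $\mathbf{x}$ if this infimum is attained, and exact if it is exact at every point of its domain. On a finite-dimensional space $Y$, a function $g:Y\to\,]-\infty,+\infty]$ is a polyhedral convex function if $g=h+\iota_C$ with $h(x)=\max\{\langle x,b_i\rangle-\beta_i: i=1,\dots,k\}$ and $C=\{x\in Y:\langle x,b_i\rangle\le\beta_i,\ i=k+1,\dots,l\}$ for some fixed finitely many $b_i\in Y$, $\beta_i\in\mathbb{R}$. Standing assumption: $\operatorname{dom}\mathbf{f}^*\cap\Delta^\perp\neq\varnothing$ ($\mathbf{f}^*$ the Fenchel conjugate). *)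

(* Defs.v *)
From HB Require Import structures.
From mathcomp Require Import all_boot all_order all_algebra.
From mathcomp Require Import sesquilinear ring lra.
From mathcomp Require Import all_classical all_reals all_analysis.

Set Implicit Arguments.
Unset Strict Implicit.
Unset Printing Implicit Defensive.

Import Order.TTheory GRing.Theory Num.Theory.
Import numFieldNormedType.Exports.

Local Open Scope classical_set_scope.
Local Open Scope ring_scope.

(* A finite-dimensional real Hilbert space is given by [X : vectType R]
   together with an inner product [ip : {dot X for idfun}], i.e. a symmetric
   positive definite bilinear form; completeness is automatic in finite
   dimension. *)

Section InnerProductNorm.
Context {R : realType} {X : vectType R} (ip : {dot X for idfun}).
Implicit Types (x y : X) (a : R).

Definition ipnorm x : R := Num.sqrt (ip x x).

Lemma ipC x y : ip x y = ip y x.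
Proof. by rewrite [LHS](@hermitian_subproof _ _ _ _ ip) expr0 mul1r. Qed.

Lemma ipDl x y z : ip (x + y) z = ip x z + ip y z.
Proof. exact: linearDl. Qed.

Lemma ipDr x y z : ip x (y + z) = ip x y + ip x z.
Proof. exact: linearDr. Qed.

Lemma ipZl a x y : ip (a *: x) y = a * ip x y.
Proof. exact: linearZl_LR. Qed.

Lemma ipZr a x y : ip x (a *: y) = a * ip x y.
Proof. by rewrite ipC ipZl ipC. Qed.

Lemma ip0l x : ip 0 x = 0.
Proof. exact: linear0l. Qed.

Lemma ip_gt0 x : x != 0 -> 0 < ip x x.
Proof. exact: neq0_dnorm_gt0. Qed.

Lemma ip_ge0 x : 0 <= ip x x.
Proof. by have [->|/ip_gt0/ltW//] := eqVneq x 0; rewrite ip0l. Qed.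

Lemma ip_cauchy_schwarz x y : ip x y <= ipnorm x * ipnorm y.
Proof.
have [->|y0] := eqVneq y 0.
  by rewrite ipC ip0l mulr_ge0 ?sqrtr_ge0.
rewrite -sqrtrM ?ip_ge0// (le_trans (ler_norm _))// -sqrtr_sqr ler_wsqrtr//.
have yy := ip_gt0 y0.
have := ip_ge0 (ip y y *: x + (- ip x y) *: y).
rewrite !(ipDl, ipDr, ipZl, ipZr) (ipC y x).
set p := ip x x; set q := ip y y in yy *; set r := ip x y => h.
rewrite -subr_ge0 -(pmulr_rge0 _ yy).
by apply: (le_trans h); rewrite le_eqVlt; apply/orP; left; apply/eqP; ring.
Qed.

Lemma ler_ipnormD x y : ipnorm (x + y) <= ipnorm x + ipnorm y.
Proof.
rewrite -(@ler_pXn2r _ 2%N) ?nnegrE ?addr_ge0 ?sqrtr_ge0//.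
rewrite sqrrD !sqr_sqrtr ?ip_ge0// !(ipDl, ipDr) (ipC y x).
have := ip_cauchy_schwarz x y; lra.
Qed.

Lemma ipnormZ a x : ipnorm (a *: x) = `|a| * ipnorm x.
Proof.
by rewrite /ipnorm ipZl ipZr mulrA -expr2 sqrtrM ?sqr_ge0// sqrtr_sqr.
Qed.

Lemma ipnorm0_eq0 x : ipnorm x = 0 -> x = 0.
Proof.
move=> h; apply/eqP; apply/negPn/negP => /ip_gt0.
by rewrite -sqrtr_gt0 -/(ipnorm x) h ltxx.
Qed.

(* [X] with the norm and topology induced by [ip]. *)
Definition hilbert (_ : {dot X for idfun}) : Type := X.

HB.instance Definition _ := GRing.Lmodule.copy (hilbert ip) X.
HB.instance Definition _ := @Lmodule_isNormed.Build R (hilbert ip) ipnorm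
  ler_ipnormD ipnormZ ipnorm0_eq0.

End InnerProductNorm.

Section ProductHilbert.
Context {R : realType} {X : vectType R} (ip : {dot X for idfun}) (m : nat).
Implicit Types x y : {ffun 'I_m -> X}.

Definition prod_ip x y : R := \sum_(i < m) ip (x i) (y i).

Let prod_ip_bilinear : bilinear_for
  (GRing.Scale.Law.clone _ _ *%R _) (GRing.Scale.Law.clone _ _ (idfun \; *%R) _)
  prod_ip.
Proof.
split=> [z|z] a x y /=; rewrite /prod_ip mulr_sumr -big_split/=;
  apply: eq_bigr => i _.
- by rewrite !ffunE ipDl ipZl.
- by rewrite !ffunE ipDr ipZr.
Qed.

HB.instance Definition _ := bilinear_isBilinear.Build R
  {ffun 'I_m -> X} {ffun 'I_m -> X} R _ _ prod_ip prod_ip_bilinear.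

Let prod_ip_sym x y : prod_ip x y = (-1) ^+ false * idfun (prod_ip y x).
Proof. by rewrite expr0 mul1r; apply: eq_bigr => i _; rewrite ipC. Qed.

HB.instance Definition _ := isHermitianSesquilinear.Build R
  {ffun 'I_m -> X} false idfun prod_ip prod_ip_sym.

Let prod_ip_gt0 x : x != 0 -> 0 < prod_ip x x.
Proof.
move=> x0; have [i xi] : exists i, x i != 0.
  apply/existsP; apply: contraNT x0 => /existsPn x0.
  by apply/eqP/ffunP => i; rewrite ffunE; apply/eqP; rewrite -[_ == _]negbK x0.
rewrite /prod_ip (bigD1 i)//= ltr_pwDl ?ip_gt0//.
by apply: sumr_ge0 => j _; exact: ip_ge0.
Qed.

HB.instance Definition _ := isDotProduct.Build R
  {ffun 'I_m -> X} prod_ip prod_ip_gt0.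

End ProductHilbert.

Arguments prod_ip {R X} ip m x y.

Local Open Scope ereal_scope.

Section ConvexAnalysis.
Context {R : realType}.

(* [g] takes its values in ]-oo, +oo] and is not identically +oo. *)
Definition proper_function {T : Type} (g : T -> \bar R) : Prop :=
  (forall x, g x != -oo) /\ (exists x, g x < +oo).

Definition edom {T : Type} (g : T -> \bar R) : set T := [set x | g x < +oo].

Definition ind {T : Type} (C : set T) (x : T) : \bar R :=
  if x \in C then 0 else +oo.

Definition inf_conv {V : lmodType R} (f g : V -> \bar R) (x : V) : \bar R :=
  ereal_inf [set f u + g (x - u)%R | u in [set: V]].

Definition inf_conv_exact_at {V : lmodType R} (f g : V -> \bar R) (x : V) :=
  exists u, inf_conv f g x = f u + g (x - u)%R.

Definition inf_conv_exact {V : lmodType R} (f g : V -> \bar R) :=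
  forall x, edom (inf_conv f g) x -> inf_conv_exact_at f g x.

Context {X : vectType R} (ip : {dot X for idfun}).

Definition fenchel (f : X -> \bar R) (y : X) : \bar R :=
  ereal_sup [set (ip x y)%:E - f x | x in [set: X]].

Definition orthogonal_complement (A : set X) : set X :=
  [set y | forall x, A x -> ip x y = 0%R].

(* The indices are 0-based, so [i < k] selects the pieces of the max and
   [k <= i < l] the constraints, of which there may be none. The max is over
   a nonempty family, as a real-valued [h] requires. *)
Definition polyhedral (g : X -> \bar R) : Prop :=
  exists (k l : nat) (b : 'I_l -> X) (beta : 'I_l -> R),
  [/\ (0 < k)%N, (k <= l)%N & forall x : X,
    g x = \big[maxe/-oo]_(i < l | (i < k)%N) (ip x (b i) - beta i)%:E
          + ind [set y | forall i : 'I_l, (k <= i)%N -> (ip y (b i) <= beta i)%R]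
              x].

Definition lsc (g : X -> \bar R) : Prop :=
  @lower_semicontinuous (hilbert ip) R g.

End ConvexAnalysis.

Definition diagonal_set {X : Type} (m : nat) : set {ffun 'I_m -> X} :=
  range (fun x : X => [ffun=> x]).

Arguments diagonal_set {X} m.

Definition separable_sum {R : realType} {X : Type} {m : nat}
    (f : 'I_m -> X -> \bar R) (x : {ffun 'I_m -> X}) : \bar R :=
  \sum_(i < m) f i (x i).

(* Main.v *)
Require Import Defs.
From HB Require Import structures.
From mathcomp Require Import all_boot all_order all_algebra sesquilinear.
From mathcomp Require Import ring lra.
From mathcomp Require Import all_classical all_reals all_analysis.

Set Implicit Arguments.
Unset Strict Implicit.
Unset Printing Implicit Defensive.

(** Write Delta for the diagonal, F for the separable sum and g for the
infimal convolution of F with the indicator of Delta.  Everything is read off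
epigraphs.

A polyhedron is the solution set of finitely many affine inequalities, and
Fourier-Motzkin elimination ([polyhedron_line]) shows that adding a linear
subspace to a polyhedron gives a polyhedron ([polyhedron_add_range]).  This is
used twice.  The inequality F(x) <= t holds iff there are auxiliary reals
tau_i with f_i(x_i) <= tau_i and sum_i tau_i <= t, a polyhedral condition on
(x, t, tau) from which tau is eliminated: the epigraph of F is a polyhedron
([polyhedron_epi_separable_sum]).  Then let P be this epigraph plus Delta x 0,
again a polyhedron.  P lies in the epigraph of g and contains all (x, t) with
g(x) < t; since P is closed, P is the epigraph of g ([epi_inf_conv_subspace]).

Exactness follows at once: if g(x) is finite, then (x, g(x)) is in P, which
provides a point where the infimum is attained.  For polyhedrality, let
l_i(x) + c_i t <= beta_i be the inequalities that define P.  Since P is stable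
under increasing t, all c_i are nonpositive; an inequality with c_i < 0 is,
after division by -c_i, an affine minorant of g, and one with c_i = 0 is a
constraint on x.  If no c_i were negative, g would take the value -oo, which
properness forbids; hence the maximum of the minorants is over a nonempty
family ([polyhedron_epi_polyhedral]).  The linear forms l_i become inner
products by the Riesz representation ([affine_fun_riesz]).  Finally, a
polyhedral function is lower semicontinuous because a < g(x) means that one of
finitely many affine inequalities is violated at x, an open condition
([polyhedral_lsc]). *)

Import Order.TTheory GRing.Theory Num.Theory.
Import numFieldNormedType.Exports.

Local Open Scope classical_set_scope.
Local Open Scope ring_scope.

(** * Affine functions *)

Section AffineFunctions.
Context {R : realType}.
Implicit Types U V : lmodType R.

(** Equivalently, [phi - phi 0] is linear; this form is preserved by
compositions and combinations without any bundling of the linear part. *)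
Definition affine_fun V (phi : V -> R) : Prop :=
  forall a x y, phi (a *: x + y) = a * (phi x - phi 0) + phi y.

Lemma affine_funD1 V (phi : V -> R) x y : affine_fun phi ->
  phi (x + y) = phi x - phi 0 + phi y.
Proof. by move=> aff; rewrite -{1}[x]scale1r aff mul1r. Qed.

Lemma affine_fun_cst V (c : R) : affine_fun (fun _ : V => c).
Proof. by move=> a x y; ring. Qed.

Lemma affine_fun_comb V (a b : R) (phi psi : V -> R) :
  affine_fun phi -> affine_fun psi ->
  affine_fun (fun x => a * phi x + b * psi x).
Proof. by move=> hphi hpsi c x y; rewrite hphi hpsi; ring. Qed.

Lemma linear_map0 U V (T : U -> V) : linear T -> T 0 = 0.
Proof.
by move=> linT; have := linT (-1) 0 0; rewrite scaler0 addr0 scaleN1r addNr.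
Qed.

Lemma linear_mapN U V (T : U -> V) x : linear T -> T (- x) = - T x.
Proof.
move=> linT; have := linT (-1) x 0.
by rewrite !scaleN1r !addr0 (linear_map0 linT) addr0.
Qed.

Lemma affine_fun_comp U V (T : U -> V) (phi : V -> R) :
  linear T -> affine_fun phi -> affine_fun (phi \o T).
Proof. by move=> linT aff a x y /=; rewrite linT aff (linear_map0 linT). Qed.

(** On [V * R], the slope of [phi] in the second variable is constant, whence
the split into a multiple of that variable and a function of the first. *)
Lemma affine_fun_slope V (phi : V * R^o -> R) x (t e : R) : affine_fun phi ->
  phi (x, t + e) = e * (phi (0, 1) - phi 0) + phi (x, t).
Proof.
move=> aff; rewrite -aff; congr (phi (_, _)); first by rewrite /= scaler0 add0r.
by rewrite /= addrC [_ *: _]mulr1.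
Qed.

Lemma linear_affine_fun V (phi : V -> R^o) : linear phi -> affine_fun phi.
Proof. by move=> lin a x y; rewrite lin (linear_map0 lin) subr0. Qed.

End AffineFunctions.

(** * Polyhedra and Fourier-Motzkin elimination *)

Section Polyhedra.
Context {R : realType}.
Implicit Types U V : lmodType R.

Definition polyhedron V (A : set V) : Prop :=
  exists (I : finType) (phi : I -> V -> R),
    (forall i, affine_fun (phi i)) /\
    forall x, A x <-> forall i, phi i x <= 0.

Lemma polyhedron_halfspace V (phi : V -> R) :
  affine_fun phi -> polyhedron [set x | phi x <= 0].
Proof.
move=> aff; exists unit, (fun=> phi); split=> // x.
by split=> [|/(_ tt)].
Qed.

Lemma polyhedron_bigcap V (J : finType) (A : J -> set V) :
  (forall j, polyhedron (A j)) -> polyhedron [set x | forall j, A j x].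
Proof.
move=> pA; have dpA j := cid (pA j).
pose I j : finType := sval (dpA j).
have dphi j := cid (svalP (dpA j) : exists phi : I j -> V -> R, _).
pose phi j := sval (dphi j); have Aphi j := svalP (dphi j).
exists {j : J & I j}, (fun p => phi (tag p) (tagged p)).
split=> [[j i]|x].
  exact: (Aphi j).1.
split=> [Ax [j i]|Ax j].
  exact: ((Aphi j).2 x).1.
by apply/(Aphi j).2 => i; exact: (Ax (Tagged I i)).
Qed.

Lemma polyhedronI V (A B : set V) :
  polyhedron A -> polyhedron B -> polyhedron (A `&` B).
Proof.
move=> pA pB; have : forall b : bool, polyhedron (if b then A else B) by case.
move=> /polyhedron_bigcap; congr (polyhedron _); apply/seteqP; split=> x /=.
  by move=> h; split; [exact: (h true)|exact: (h false)].
by case=> Ax Bx [].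
Qed.

Lemma polyhedron_preimage U V (T : U -> V) (A : set V) :
  linear T -> polyhedron A -> polyhedron (T @^-1` A).
Proof.
move=> linT [I [phi [aff Aphi]]]; exists I, (fun i => phi i \o T).
by split=> [i|x]; [exact: affine_fun_comp|exact: Aphi].
Qed.

Lemma finite_separation (I : finType) (P Q : pred I) (l u : I -> R) :
  (forall i j, P i -> Q j -> l i <= u j) ->
  exists s, (forall i, P i -> l i <= s) /\ (forall j, Q j -> s <= u j).
Proof.
move=> lu; have [i0 Pi0|P0] := pickP P.
  have [i Pi imax] := @arg_maxP _ _ _ i0 P l Pi0.
  by exists (l i); split=> [k /imax//|j]; exact: lu.
have [j0 Qj0|Q0] := pickP Q; last first.
  by exists 0; split=> [i|j]; rewrite ?P0 ?Q0.
have [j Qj jmin] := @arg_minP _ _ _ j0 Q u Qj0.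
by exists (u j); split=> [i|k /jmin//]; rewrite P0.
Qed.

(** Fourier-Motzkin elimination of [s].  With [c i] the slope of [phi i] along
[v], the constraint [phi i (x + s *: v) <= 0] is a lower bound on [s] if
[c i < 0], an upper bound if [c i > 0], and does not involve [s] if [c i = 0].
An admissible [s] exists iff every lower bound is below every upper bound, and
each of these comparisons is again affine in [x] once the denominators are
cleared. *)
Lemma polyhedron_line V (v : V) (A : set V) :
  polyhedron A -> polyhedron [set x | exists s : R, A (x + s *: v)].
Proof.
move=> [I [phi [aff Aphi]]].
pose c i := phi i v - phi i 0.
have phiE i x s : phi i (x + s *: v) = s * c i + phi i x.
  by rewrite addrC aff.
(* Where the slopes do not have the relevant signs, the constraint is the
   vacuous 0 <= 0, so that the new index type need not be a subtype. *)
pose psi (k : I + I * I) x := match k with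
  | inl i => if c i == 0 then phi i x else 0
  | inr (i, j) =>
      if (0 < c i) && (c j < 0) then c i * phi j x + (- c j) * phi i x else 0
  end.
exists (I + I * I)%type, psi; split=> [[i|[i j]]|x] /=.
- rewrite /psi; case: (c i == 0); [exact: aff|exact: affine_fun_cst].
- rewrite /psi; case: (_ && _); last exact: affine_fun_cst.
  exact: affine_fun_comb.
split=> [[s /Aphi Axs] [i|[i j]] /=|psix].
- case: ifPn => // /eqP ci0.
  by have := Axs i; rewrite phiE ci0 mulr0 add0r.
- case: ifPn => // /andP[ci cj].
  have := Axs i; have := Axs j; rewrite !phiE => hj hi.
  have -> : c i * phi j x + - c j * phi i x =
      c i * (s * c j + phi j x) + - c j * (s * c i + phi i x) by ring.
  rewrite -[leRHS]addr0; apply: lerD; apply: mulr_ge0_le0 => //.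
    exact: ltW.
  by rewrite oppr_ge0 ltW.
have [s [sl su]] : exists s,
    (forall j, c j < 0 -> - phi j x / c j <= s) /\
    (forall i, 0 < c i -> s <= - phi i x / c i).
  apply: finite_separation => j i cj ci.
  have := psix (inr (i, j)); rewrite /= ci cj/= => h.
  rewrite ler_pdivlMr// mulrAC ler_ndivrMr//.
  by lra.
exists s; apply/Aphi => i; rewrite phiE.
have [ci|ci|ci] := ltgtP (c i) 0.
- by have := sl i ci; rewrite ler_ndivrMr//; lra.
- by have := su i ci; rewrite ler_pdivlMr//; lra.
- by have := psix (inl i); rewrite /= ci eqxx mulr0 add0r.
Qed.

(** The subspace is added one line at a time, along the images of a basis of
[W].  The range of [L] rather than a subspace is used because [V] need not be
finite-dimensional. *)
Lemma polyhedron_add_range V (W : vectType R) (L : W -> V) (A : set V) :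
  linear L -> polyhedron A -> polyhedron [set x | exists w, A (x + L w)].
Proof.
move=> linL pA.
pose comb (e : seq W) (s : nat -> R) := \sum_(i < size e) s i *: e`_i.
have pe (e : seq W) : polyhedron [set x | exists s, A (x + L (comb e s))].
  elim: e => [|w e IH].
    have -> // : [set x | exists s, A (x + L (comb [::] s))] = A.
    have E s : L (comb [::] s) = 0 by rewrite /comb big_ord0 linear_map0.
    apply/seteqP; split=> x /=; last by exists (fun=> 0); rewrite E addr0.
    by case=> s; rewrite E addr0.
  have -> : [set x | exists s, A (x + L (comb (w :: e) s))] =
      [set x | exists t,
        [set x | exists s, A (x + L (comb e s))] (x + t *: L w)].
    have E s : L (comb (w :: e) s) = s 0%N *: L w + L (comb e (s \o S)).
      by rewrite -linL /comb /= big_ord_recl.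
    apply/seteqP; split=> x /=.
      by case=> s; rewrite E addrA; exists (s 0%N), (s \o S).
    case=> t [s Ast]; exists (fun n => if n is n'.+1 then s n' else t).
    by rewrite E addrA.
  exact: polyhedron_line.
move: (pe (vbasis {:W})); congr (polyhedron _); apply/seteqP; split=> x /=.
  by case=> s ?; eexists; eassumption.
case=> w Aw.
exists (fun i => if insub i is Some k then coord (vbasis {:W}) k w else 0).
rewrite /comb; set y := \sum_(i < _) _; suff -> : y = w by [].
rewrite [RHS](coord_vbasis (memvf w)) /y size_tuple.
by apply: eq_bigr => i _; rewrite valK.
Qed.

End Polyhedra.

(** * Functions with a polyhedral epigraph *)

Section Epigraphs.
Context {R : realType}.
Local Open Scope ereal_scope.

(** The second factor is [R^o] so that the product is an [R]-module. *)
Definition epi {V : lmodType R} (g : V -> \bar R) : set (V * R^o) :=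
  [set p | g p.1 <= (p.2 : R)%:E].

Lemma le_of_fin_ubound (a b : \bar R) :
  (forall t : R, b <= t%:E -> a <= t%:E) -> a <= b.
Proof.
case: b => [b|_|ab]; [exact|exact: leey|].
by rewrite [a]eq_ninfty// => t; apply: ab; exact: leNye.
Qed.

(** The vertical form of the fact that polyhedra are closed: an affine function
that is positive at [(x, t)] is still positive slightly above that point. *)
Lemma polyhedron_closed_up {V : lmodType R} (A : set (V * R^o)) x (t : R) :
  polyhedron A -> (forall t' : R, (t < t')%R -> A (x, t')) -> A (x, t).
Proof.
move=> [I [phi [aff Aphi]]] At; apply/Aphi => i.
pose c := (phi i (0%R, 1%R) - phi i 0)%R.
rewrite leNgt; apply/negP => p0.
have c1 : (0 < `|c| + 1 :> R)%R by rewrite ltr_wpDl.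
(* At this height [phi i] has decreased by at most [e * `|c|], which is less
   than its initial value [e * (`|c| + 1)]. *)
pose e := (phi i (x, t) / (`|c| + 1))%R.
have e0 : (0 < e)%R by rewrite divr_gt0.
have pe : phi i (x, t) = (e * (`|c| + 1))%R by rewrite divfK// gt_eqF.
have := (Aphi (x, t + e)%R).1 (At _ _) i.
rewrite ltrDl affine_fun_slope// -/c => /(_ e0).
rewrite pe -mulrDr leNgt mulr_gt0//.
have := lerNnormlW (lexx `|c|)%R; lra.
Qed.

Section SeparableSum.
Context {X : lmodType R} {m : nat}.

(** A finite sum is at most [t] iff its terms have upper bounds [tau i] whose
sum is at most [t]; the polyhedron [A] of all [(x, t, tau)] is saturated along
the [tau] directions and then cut by [tau = 0]. *)
Lemma polyhedron_epi_separable_sum (f : 'I_m -> X -> \bar R) :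
  (forall i x, f i x != -oo) -> (forall i, polyhedron (epi (f i))) ->
  polyhedron (epi (separable_sum f : {ffun 'I_m -> X} -> \bar R)).
Proof.
move=> fNy pf.
pose E := (({ffun 'I_m -> X} * R^o) * {ffun 'I_m -> R^o})%type.
pose A : set E := [set p : E | forall i, epi (f i) (p.1.1 i, p.2 i)] `&`
                  [set p : E | (\sum_i p.2 i - p.1.2 <= 0)%R].
have pA : polyhedron A.
  apply: polyhedronI.
    apply: polyhedron_bigcap => i.
    apply: (@polyhedron_preimage _ _ _ (fun p : E => (p.1.1 i, p.2 i))) => //.
    by move=> a x y /=; rewrite !ffunE.
  apply: polyhedron_halfspace; apply: linear_affine_fun => a x y /=.
  rewrite scalerBr scaler_sumr.
  under eq_bigr do rewrite !ffunE.
  by rewrite big_split/= opprD addrACA.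
pose lift (p : {ffun 'I_m -> X} * R^o) : E := (p, 0%R).
pose shift (tau : {ffun 'I_m -> R^o}) : E := (0%R, tau).
have : polyhedron (lift @^-1` [set q : E | exists tau, A (q + shift tau)%R]).
  apply: polyhedron_preimage.
    by move=> a x y; congr (_, _); rewrite /= scaler0 addr0.
  apply: polyhedron_add_range pA => a x y.
  by congr (_, _); rewrite /= scaler0 addr0.
congr (polyhedron _); apply/seteqP; split=> -[x t] /=.
  case=> tau [/= ftau]; rewrite addr0 subr_le0 add0r => le_t.
  apply: (@le_trans _ _ (\sum_i (tau i)%:E)); last by rewrite sumEFin lee_fin.
  apply: lee_sum => i _; have := ftau i.
  by rewrite /epi/= addr0 add0r.
move=> Fxt.
have fin i : f i (x i) \is a fin_num.
  rewrite fin_numE fNy/=; apply/negP => /eqP fy.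
  suff sy : separable_sum f x = +oo by move: Fxt; rewrite /epi/= sy.
  by apply/esum_eqyP => // ; exists i; rewrite mem_index_enum.
exists [ffun i => fine (f i (x i))]; split=> /= [i|].
  by rewrite /epi/= addr0 add0r ffunE fineK.
rewrite addr0 add0r subr_le0 -lee_fin -sumEFin.
by under eq_bigr do rewrite ffunE fineK//.
Qed.

End SeparableSum.

Section InfConvSubspace.
Context {V : lmodType R} {W : vectType R} (L : W -> V) (F : V -> \bar R).
Hypothesis linL : linear L.
Hypothesis FNy : forall u, F u != -oo.
Let g := inf_conv F (ind (range L)).

Lemma inf_conv_subspace_le x w : g x <= F (x + L w)%R.
Proof.
apply: ge_ereal_inf; exists (F (x + L w)%R) => //; exists (x + L w)%R => //.
rewrite /ind mem_set ?adde0//; exists (- w)%R => //.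
by rewrite (linear_mapN _ linL) opprD addNKr.
Qed.

Lemma inf_conv_subspace_lt x (t : R) :
  g x < t%:E -> exists w, F (x + L w)%R <= t%:E.
Proof.
move=> /ereal_inf_lt[_ [u _ <-]]; rewrite /ind; case: ifPn => [|_].
  rewrite inE => -[w _ Lw]; rewrite adde0 => /ltW Fu; exists (- w)%R.
  by rewrite (linear_mapN _ linL) Lw subKr.
by rewrite addey.
Qed.

Hypothesis pF : polyhedron (epi F).

(** In general the sum of the epigraph of [F] and the subspace only lies
between the strict and the full epigraph of [g]; being a polyhedron, it is
closed and therefore is the full one. *)
Lemma epi_inf_conv_subspace :
  epi g = [set p | exists w, epi F (p + (L w, 0))%R] /\ polyhedron (epi g).
Proof.
set P := [set p | _].
have pP : polyhedron P.
  apply: polyhedron_add_range pF => a x y.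
  by congr (_, _); rewrite ?linL//= scaler0 addr0.
suff gP : epi g = P by rewrite gP.
apply/seteqP; split=> -[x t].
  move=> /= gxt; apply: polyhedron_closed_up pP _ => t' tt'.
  have [|w Fw] := @inf_conv_subspace_lt x t'.
    by rewrite (le_lt_trans gxt)// lte_fin.
  by exists w; rewrite /epi/= addr0.
case=> w; rewrite /epi/= addr0 => Fw.
exact: le_trans (inf_conv_subspace_le x w) Fw.
Qed.

(** The point [(x, g x)] of the epigraph of [g] is a translate of a point of
the epigraph of [F], and the translation gives the minimizer. *)
Lemma inf_conv_subspace_exact :
  (forall x, g x != -oo) -> inf_conv_exact F (ind (range L)).
Proof.
move=> gNy x; rewrite /edom/= -/g => gx.
have gfin : g x \is a fin_num by rewrite fin_numE gNy lt_eqF.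
have : epi g (x, fine (g x)) by rewrite /epi/= fineK.
rewrite epi_inf_conv_subspace.1 => -[w]; rewrite /epi/= addr0 fineK// => Fw.
exists (x + L w)%R; rewrite /ind mem_set ?adde0.
  by apply/le_anti; rewrite inf_conv_subspace_le Fw.
by exists (- w)%R => //; rewrite (linear_mapN _ linL) opprD addNKr.
Qed.

End InfConvSubspace.
End Epigraphs.

(** * Affine functions as inner products *)

Section Riesz.
Context {R : realType} {V : vectType R} (ip : {dot V for idfun}).

(** The map [coords] sending [y] to its inner products with a basis is
injective because the inner product is definite, so it is onto by equality of
dimensions; [b] is a preimage of the values of the linear part of [phi] on the
basis. *)
Lemma affine_fun_riesz (phi : V -> R) :
  affine_fun phi -> exists b beta, forall x, phi x = ip x b - beta.
Proof.
move=> aff; set n := \dim {:V}; set e := vbasis {:V}.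
pose coords (y : V) : 'rV[R]_n := \row_i ip e`_i y.
have lin_coords : linear coords.
  by move=> a x y; apply/rowP => i; rewrite !mxE ipDr ipZr.
pose coords_isLinear :=
  GRing.isLinear.Build R V 'rV[R]_n *:%R coords lin_coords.
pose C : 'Hom(V, 'rV[R]_n) :=
  linfun (HB.pack coords coords_isLinear : {linear V -> 'rV[R]_n}).
have CE y : C y = coords y by rewrite lfunE.
have ip_coord x y : ip x y = \sum_(i < n) coord e i x * ip e`_i y.
  rewrite {1}(coord_vbasis (memvf x)).
  rewrite (big_morph (ip^~ y) (fun u v => ipDl ip u v y) (ip0l ip y)).
  by apply: eq_bigr => i _; rewrite ipZl.
have kerC : lker C = 0%VS.
  apply/eqP; rewrite -subv0; apply/subvP => y; rewrite memv_ker memv0 CE.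
  move=> /eqP y0; apply: contraT => /(ip_gt0 ip).
  rewrite ip_coord big1 ?ltxx// => i _.
  by have /rowP/(_ i) := y0; rewrite !mxE => ->; rewrite mulr0.
have imC : limg C = fullv.
  apply/eqP; rewrite -(dimv_leqif_eq (subvf _)) limg_dim_eq ?kerC ?capv0//.
  by rewrite [X in _ == X]dimvf /dim/= mul1n.
have : \row_(i < n) (phi e`_i - phi 0) \in limg C by rewrite imC memvf.
case/memv_imgP => b _ /rowP phib; exists b, (- phi 0) => x.
rewrite opprK ip_coord; apply/eqP; rewrite -subr_eq; apply/eqP.
transitivity (\sum_(i < n) coord e i x * (phi e`_i - phi 0)); last first.
  by apply: eq_bigr => i _; have := phib i; rewrite CE !mxE => ->.
pose psi x := phi x - phi 0.
have psiD y z : psi (y + z) = psi y + psi z.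
  by rewrite /psi affine_funD1//; ring.
have psiZ a y : psi (a *: y) = a * psi y.
  by rewrite /psi -[a *: y]addr0 aff addrK.
have psi0 : psi 0 = 0 by rewrite /psi subrr.
rewrite -/(psi x) {1}(coord_vbasis (memvf x)) (big_morph psi psiD psi0).
by apply: eq_bigr => i _; rewrite psiZ.
Qed.

End Riesz.

(** * Polyhedral functions *)

Section PolyhedralFunctions.
Context {R : realType} {X : vectType R} (ip : {dot X for idfun}).
Local Open Scope ereal_scope.

(** The sublevel sets of a polyhedral function, with pieces and constraints
treated uniformly.  The hypothesis [0 < k] matters: with no piece the maximum
would be [-oo], and [-oo + +oo] is [-oo], so violated constraints would go
unnoticed. *)
Lemma le_max_add_ind (k l : nat) (b : 'I_l -> X) (beta : 'I_l -> R) x (t : R) :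
  (0 < k)%N -> (k <= l)%N ->
  \big[maxe/-oo]_(i < l | (i < k)%N) (ip x (b i) - beta i)%:E
    + ind [set y | forall i : 'I_l, (k <= i)%N -> (ip y (b i) <= beta i)%R] x
    <= t%:E <->
  forall i, (ip x (b i) - beta i <= if (i < k)%N then t else 0)%R.
Proof.
move=> k0 kl; set M := \big[maxe/-oo]_(i < l | _) _.
have M_gtNy : M != -oo.
  pose j0 := Ordinal (leq_trans k0 kl).
  rewrite -ltNye (@lt_le_trans _ _ (ip x (b j0) - beta j0)%:E)// ?ltNyr//.
  exact: (le_bigmax_cond _ (fun i => (ip x (b i) - beta i)%:E)).
have M_le : M <= t%:E <->
    forall i : 'I_l, (i < k)%N -> (ip x (b i) - beta i <= t)%R.
  split=> [/bigmax_leP[_ h] i ik|h].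
    by rewrite -lee_fin h.
  by apply/bigmax_leP; split=> [|i ik]; rewrite ?leNye// lee_fin h.
rewrite /ind; case: ifPn; rewrite ?inE/= => C.
  rewrite adde0; split=> [/M_le h i|h].
    by case: ltnP => ik; [exact: h|rewrite subr_le0 C].
  by apply/M_le => i ik; have := h i; rewrite ik.
split=> [|h]; first by rewrite addey// leye_eq.
exfalso; apply: (negP C); rewrite inE => i ki.
by have := h i; rewrite ltnNge ki/= subr_le0.
Qed.

Lemma polyhedral_epi (g : X -> \bar R) :
  polyhedral ip g -> polyhedron (epi g).
Proof.
move=> [k [l [b [beta [k0 kl gE]]]]].
exists 'I_l, (fun i (p : X * R^o) =>
  (ip p.1 (b i) - beta i - (if (i < k)%N then p.2 else 0))%R).
split=> [i a p q /=|[x t]].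
  by rewrite ipDl ipZl ip0l; case: ifP => _; rewrite /GRing.scale/=; ring.
rewrite /epi/= gE; split=> [/(le_max_add_ind _ _ _ _ k0 kl) h i|h].
  by rewrite subr_le0.
by apply/(le_max_add_ind _ _ _ _ k0 kl) => i; rewrite -subr_le0.
Qed.

(** If [a < g x], then some piece exceeds [a] at [x] or some constraint is
violated at [x]; by the Cauchy-Schwarz inequality the same one does so on a
ball around [x]. *)
Lemma polyhedral_lsc (g : X -> \bar R) : polyhedral ip g -> lsc ip g.
Proof.
move=> [k [l [b [beta [k0 kl gE]]]]] x a; rewrite ltNge gE => /negP agx.
have [i ai] : exists i : 'I_l,
    ((if (i < k)%N then a else 0) < ip x (b i) - beta i)%R.
  apply/not_existsP => h; apply: agx; apply/(le_max_add_ind _ _ _ _ k0 kl) => i.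
  by rewrite leNgt; apply/negP; exact: h.
set c := (if _ then _ else _) in ai.
(* The radius is the slack divided by [ipnorm ip (b i) + 1] rather than by
   [ipnorm ip (b i)], which may be zero. *)
have [e e0 eb] : exists2 e : R, (0 < e)%R &
    (e * ipnorm ip (b i) < ip x (b i) - beta i - c)%R.
  have d0 : (0 < ip x (b i) - beta i - c)%R by rewrite subr_gt0.
  have n1 : (0 < ipnorm ip (b i) + 1)%R by rewrite ltr_wpDl// sqrtr_ge0.
  exists ((ip x (b i) - beta i - c) / (ipnorm ip (b i) + 1))%R.
    by rewrite divr_gt0.
  by rewrite mulrAC ltr_pdivrMr// ltr_pM2l// ltrDl.
exists (ball x e); first exact: nbhsx_ballx.
move=> y; rewrite -ball_normE/= => xy; rewrite ltNge gE; apply/negP.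
move=> /(le_max_add_ind _ _ _ _ k0 kl)/(_ i); rewrite -/c leNgt => /negP; apply.
have xyb : (ip x (b i) - ip y (b i) <= ipnorm ip (x - y) * ipnorm ip (b i))%R.
  have := ip_cauchy_schwarz ip (x - y)%R (b i).
  by rewrite ipDl -scaleN1r ipZl mulN1r.
have xye : (ipnorm ip (x - y) * ipnorm ip (b i) <= e * ipnorm ip (b i))%R.
  by rewrite ler_wpM2r ?sqrtr_ge0// ltW.
lra.
Qed.

(** An inequality defining the epigraph has a nonpositive slope [c i] in the
second variable.  Those with [c i < 0] are normalized to slope -1 and become
the pieces, those with [c i = 0] the constraints; [s1] and [s2] list the two
kinds in this order.  Properness yields one piece at least. *)
Lemma polyhedron_epi_polyhedral (g : X -> \bar R) :
  proper_function g -> polyhedron (epi g) -> polyhedral ip g.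
Proof.
move=> [gNy [x0 gx0]] [I [phi [aff epiE]]].
pose c i := (phi i (0, 1) - phi i 0)%R.
have phiD i x (t e : R) : phi i (x, t + e)%R = (e * c i + phi i (x, t))%R.
  exact: affine_fun_slope.
have gfin : g x0 \is a fin_num by rewrite fin_numE gNy lt_eqF.
have c_le0 i : (c i <= 0)%R.
  rewrite leNgt; apply/negP => ci.
  have p0 : (phi i (x0, fine (g x0)) <= 0)%R.
    by apply: (epiE (x0, fine (g x0))).1; rewrite /epi/= fineK.
  (* Chosen so that [phi i] takes the value 1 at height [e] above [g x0]. *)
  pose e := ((1 - phi i (x0, fine (g x0))) / c i)%R.
  have e0 : (0 <= e)%R by apply: divr_ge0; [lra|exact: ltW].
  have : epi g (x0, fine (g x0) + e)%R.
    by rewrite /epi/= EFinD fineK// leeDl// lee_fin.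
  by move/epiE => /(_ i); rewrite phiD divfK ?gt_eqF// subrK ler10.
have [i0 ci0] : exists i, (c i < 0)%R.
  (* Otherwise the fibre of the epigraph over [x0] is a whole line. *)
  apply/not_existsP => h; move: (gNy x0); apply/negP; rewrite negbK; apply/eqP.
  apply: eq_ninfty => t; have -> : t = (fine (g x0) + (t - fine (g x0)))%R.
    by rewrite addrC subrK.
  apply/(epiE (x0, _)) => i; rewrite phiD.
  have -> : c i = 0%R.
    by apply/eqP; rewrite eq_le c_le0 leNgt; apply/negP; exact: h.
  by rewrite mulr0 add0r; apply: (epiE (x0, _)).1; rewrite /epi/= fineK.
have phi0E i : exists b beta, forall x,
    phi i (x, 0%R) = (ip x b - beta)%R.
  apply: affine_fun_riesz => a x y; rewrite -[RHS]aff; congr (phi i (_, _)).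
  by rewrite /= scaler0 addr0.
have {phi0E}[b0 /choice[beta0 phi0E]] := choice phi0E.
have phiE i x (t : R) : phi i (x, t) = (t * c i + (ip x (b0 i) - beta0 i))%R.
  by rewrite -phi0E -phiD add0r.
pose scale i : R := if (c i < 0)%R then (- c i)^-1%R else 1%R.
have le_piece i x (t : R) : (phi i (x, t) <= 0)%R <->
    (ip x (scale i *: b0 i) - scale i * beta0 i <=
      if (c i < 0)%R then t else 0)%R.
  rewrite ipZr -mulrBr /scale phiE; case: ltP => ci.
    by rewrite [(_^-1 * _)%R]mulrC ler_pdivrMr ?oppr_gt0// mulrN; split; lra.
  have -> : c i = 0%R by apply/eqP; rewrite eq_le c_le0.
  by rewrite mulr0 add0r mul1r.
pose s1 := [seq i <- enum I | (c i < 0)%R].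
pose s2 := [seq i <- enum I | ~~ (c i < 0)%R].
have mem_s i : i \in s1 ++ s2.
  by rewrite mem_cat !(mem_enum, mem_filter) !andbT orbN.
pose idx := tnth (in_tuple (s1 ++ s2)).
have idx_lt (j : 'I_(size (s1 ++ s2))) : (j < size s1)%N = (c (idx j) < 0)%R.
  rewrite /idx (tnth_nth i0)/= nth_cat; case: ltnP => js.
    by have := mem_nth i0 js; rewrite mem_filter => /andP[->].
  have : (j - size s1 < size s2)%N by rewrite ltn_subLR// -size_cat.
  by move=> /(mem_nth i0); rewrite mem_filter => /andP[/negbTE->].
have k0 : (0 < size s1)%N.
  by rewrite size_filter -has_count; apply/hasP; exists i0; rewrite ?mem_enum.
have kl : (size s1 <= size (s1 ++ s2))%N by rewrite size_cat leq_addr.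
exists (size s1), (size (s1 ++ s2)), (fun j => scale (idx j) *: b0 (idx j))%R,
  (fun j => scale (idx j) * beta0 (idx j))%R; split=> // x.
have gE (t : R) : g x <= t%:E <-> forall j,
    (ip x (scale (idx j) *: b0 (idx j)) - scale (idx j) * beta0 (idx j) <=
       if (j < size s1)%N then t else 0)%R.
  split=> [/(epiE (x, t)) h j|h]; first by rewrite idx_lt; apply/le_piece.
  apply/(epiE (x, t)) => i; have /seq_tnthP[j ->] := mem_s i.
  by apply/le_piece; rewrite -/(idx j) -idx_lt.
apply/le_anti/andP; split; apply: le_of_fin_ubound => t.
  by move=> /(le_max_add_ind _ _ _ _ k0 kl)/gE.
by move=> /gE h; apply/(le_max_add_ind _ _ _ _ k0 kl).
Qed.

End PolyhedralFunctions.

(** * The infimal convolution with the diagonal *)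

Local Open Scope ereal_scope.

Theorem proposition5p4 (R : realType) (X : vectType R) (ip : {dot X for idfun})
    (m : nat) (f : 'I_m -> X -> \bar R) :
  (0 < m)%N ->
  (forall i, proper_function (f i)) ->
  (forall i, polyhedral ip (f i)) ->
  edom (fenchel (prod_ip ip m) (separable_sum f))
    `&` orthogonal_complement (prod_ip ip m) (diagonal_set m) !=set0 ->
  proper_function (inf_conv (separable_sum f) (ind (diagonal_set m))) ->
  [/\ polyhedral (prod_ip ip m)
        (inf_conv (separable_sum f) (ind (diagonal_set m))),
      lsc (prod_ip ip m)
        (inf_conv (separable_sum f) (ind (diagonal_set m))) &
      inf_conv_exact (separable_sum f) (ind (diagonal_set m))].
Proof.
move=> _ fproper fpoly _ gproper.
have diag_linear : linear (fun z : X => [ffun=> z] : {ffun 'I_m -> X}).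
  by move=> a y z; apply/ffunP => i; rewrite !ffunE.
have FNy u : separable_sum f u != -oo.
  apply/negP => /eqP/esum_eqNyP[i [_ _ fi]].
  by have := (fproper i).1 (u i); rewrite fi.
have pF : polyhedron (epi (separable_sum f : {ffun 'I_m -> X} -> \bar R)).
  apply: polyhedron_epi_separable_sum => [i|i]; first exact: (fproper i).1.
  exact: polyhedral_epi (fpoly i).
have gpoly : polyhedral (prod_ip ip m)
    (inf_conv (separable_sum f) (ind (diagonal_set m))).
  apply: polyhedron_epi_polyhedral gproper _.
  exact: (epi_inf_conv_subspace diag_linear FNy pF).2.
split=> //; first exact: polyhedral_lsc.
exact: (inf_conv_subspace_exact diag_linear FNy pF gproper.1).
Qed.
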